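(* Let $A$ be a ring. Let $B$ be an $A$-algebra. Let $(I_\rho)_{\rho\in\mathbb{N}}$ and $(J_\rho)_{\rho\in\mathbb{N}}$ be two ideal semifiltrations of $A$. Let $x\in B$ and $y\in B$. Let $m\in\mathbb{N}$ and $n\in\mathbb{N}$. Assume that $x$ is $m$-integral over $\left(A,(I_\rho)_{\rho\in\mathbb{N}}\right)$, and that $y$ is $n$-integral over $\left(A,(J_\rho)_{\rho\in\mathbb{N}}\right)$. Then $xy$ is $nm$-integral over $\left(A,(I_\rho J_\rho)_{\rho\in\mathbb{N}}\right)$.
   Context: All rings are commutative with unity, and ''$A$-algebra'' means commutative unital $A$-algebra (the structure map $A\to B$ need not be injective). $\mathbb{N}=\{0,1,2,\ldots\}$. An ideal semifiltration of a ring $A$ is a sequence $(I_\rho)_{\rho\in\mathbb{N}}$ of ideals of $A$ such that $I_0=A$ and $I_aI_b\subseteq I_{a+b}$ for all $a,b\in\mathbb{N}$. If $(I_\rho)_{\rho\in\mathbb{N}}$ and $(J_\rho)_{\rho\in\mathbb{N}}$ are ideal semifiltrations of $A$, then so is the sequence $(I_\rho J_\rho)_{\rho\in\mathbb{N}}$ of products of ideals. Given an ideal semifiltration $(I_\rho)_{\rho\in\mathbb{N}}$ of $A$ and $n\in\mathbb{N}$, an element $u$ of an $A$-algebra $B$ is called $n$-integral over $(A,(I_\rho)_{\rho\in\mathbb{N}})$ if there exists $(a_0,a_1,\ldots,a_n)\in A^{n+1}$ such that $\sum_{k=0}^{n}a_ku^k=0$, $a_n=1$, and $a_i\in I_{n-i}$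 for every $i\in\{0,1,\ldots,n\}$. *)

(* Defs.v *)
From mathcomp Require Import all_boot all_algebra.
From mathcomp Require Import classical_sets.

Set Implicit Arguments.
Unset Strict Implicit.
Unset Printing Implicit Defensive.

Import GRing.Theory.
Local Open Scope classical_set_scope.
Local Open Scope ring_scope.

(* Rings are [comPzRingType] so that the zero ring is allowed, and ideals are
   [set]s, not MathComp's [idealr]: the latter are boolean and proper, whereas
   here the unit ideal must be an ideal. *)
Definition is_ideal (A : comPzRingType) (I : set A) : Prop :=
  [/\ I 0,
      forall a b : A, I a -> I b -> I (a + b) &
      forall c a : A, I a -> I (c * a)].

Definition ideal_mul (A : comPzRingType) (I J : set A) : set A :=
  [set c | exists s : seq (A * A),
     (forall p, p \in s -> I p.1 /\ J p.2) /\ c = \sum_(p <- s) p.1 * p.2].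

Definition ideal_semifiltration (A : comPzRingType) (I : nat -> set A) : Prop :=
  [/\ forall r : nat, is_ideal (I r),
      I 0%N = setT &
      forall a b : nat, ideal_mul (I a) (I b) `<=` I (a + b)%N].

Definition semifiltration_mul (A : comPzRingType) (I J : nat -> set A) :
  nat -> set A := fun r => ideal_mul (I r) (J r).

(* An A-algebra is a ring B with a structure map f : A -> B; the library's
   [comAlgType A] would exclude B = 0, which is the only case in which
   0-integral elements exist. *)
Definition n_integral (A B : comPzRingType) (f : {rmorphism A -> B})
    (I : nat -> set A) (n : nat) (u : B) : Prop :=
  exists a : 'I_n.+1 -> A,
    [/\ \sum_(k < n.+1) f (a k) * u ^+ k = 0,
        a ord_max = 1 &
        forall i : 'I_n.+1, I (n - i)%N (a i)].

Lemma ideal_mul_ideal (A : comPzRingType) (I J : set A) :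
  is_ideal I -> is_ideal J -> is_ideal (ideal_mul I J).
Proof.
case=> I0 ID IM [J0 JD JM]; split.
- by exists [::]; split=> //; rewrite big_nil.
- move=> a b [s [sP ->]] [t [tP ->]]; exists (s ++ t); rewrite big_cat.
  by split=> // p; rewrite mem_cat => /orP[/sP|/tP].
- move=> c a [s [sP ->]]; exists [seq (c * p.1, p.2) | p <- s]; split.
    by move=> p /mapP[q /sP[Iq Jq] ->]; split=> //=; apply: IM.
  by rewrite big_map mulr_sumr; apply: eq_bigr => p _; rewrite mulrA.
Qed.

Lemma ideal_mul_sub (A : comPzRingType) (I J K : set A) :
  is_ideal K -> (forall a b, I a -> J b -> K (a * b)) -> ideal_mul I J `<=` K.
Proof.
case=> K0 KD _ IJK _ [s [sP ->]]; rewrite big_seq.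
by apply: (big_ind K) => // p /sP[]; apply: IJK.
Qed.

Lemma ideal_mul_mem (A : comPzRingType) (I J : set A) (a b : A) :
  I a -> J b -> ideal_mul I J (a * b).
Proof.
move=> Ia Jb; exists [:: (a, b)]; rewrite big_seq1; split=> // p.
by rewrite inE => /eqP->.
Qed.

Lemma semifiltration_mulP (A : comPzRingType) (I J : nat -> set A) :
  ideal_semifiltration I -> ideal_semifiltration J ->
  ideal_semifiltration (semifiltration_mul I J).
Proof.
case=> idI I0 IM [idJ J0 JM].
have idIJ r : is_ideal (semifiltration_mul I J r) by exact: ideal_mul_ideal.
split=> //.
  apply/seteqP; split=> // c _; rewrite -[c]mulr1.
  by apply: ideal_mul_mem; rewrite (I0, J0).
move=> a b; apply: ideal_mul_sub => // _ y [s [sP ->]] [t [tP ->]].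
have [K0 KD _] := idIJ (a + b)%N.
rewrite mulr_suml big_seq; apply: (big_ind (semifiltration_mul I J (a + b)%N)) => //.
move=> p /sP[Ip Jp]; rewrite mulr_sumr big_seq.
apply: (big_ind (semifiltration_mul I J (a + b)%N)) => // q /tP[Iq Jq].
rewrite mulrACA; apply: ideal_mul_mem.
  exact/IM/ideal_mul_mem.
exact/JM/ideal_mul_mem.
Qed.

(* Main.v *)
Require Import Defs.
From HB Require Import structures.
From mathcomp Require Import all_boot all_algebra.
From mathcomp Require Import classical_sets.
From mathcomp Require Import perm.

(** Let P be the companion matrix of the polynomial that witnesses the
    m-integrality of x, so that multiplication by x on the family
    (1, x, ..., x^(m-1)) is given by P, and let Q be the one for y.  The
    Kronecker product M of P and Q then describes multiplication by xy on the
    nm elements x^i y^j.  Since 1 is one of them, the determinant trick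
    ([horner_char_poly_eigen]) shows that xy is a root of the characteristic
    polynomial of M, which is monic of degree nm.

    What remains is to locate its coefficients.  The entry P i k is either zero
    or lies in I_(i + 1 - k) ([companion_matrix]).  So, if I is extended by zero
    ideals to negative indices, P i k has degree i + 1 - k in a Z-graded sense,
    and the entry of M at ((i, j), (k, l)) has bidegree (i + 1 - k, j + 1 - l)
    with respect to the ideals I_a J_b.  Such a matrix is homogeneous of degree
    (1, 1) up to a shift of its rows and columns; in the Leibniz expansion of
    the characteristic polynomial these shifts cancel along every permutation,
    so that when X is given degree (1, 1) the characteristic polynomial is
    homogeneous of degree (nm, nm) ([homogeneous_char_poly]).  Its coefficient
    of X^k therefore lies in I_(nm - k) J_(nm - k).

    Polynomials and their determinants live over nonzero rings, so the case
    B = 0, where everything is integral, is treated apart.  If B is nonzero,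
    then so is A. *)

Import GRing.Theory.
Local Open Scope ring_scope.

Set Implicit Arguments.
Unset Strict Implicit.
Unset Printing Implicit Defensive.

(** The gradings needed are by Z and by Z x Z.  A semifiltration need not be
    decreasing, so an element of degree d may not be moved to a smaller degree:
    all degrees below are tracked exactly, as in a graded ring. *)
Definition graded_ideals (G : zmodType) (A : comPzRingType) (K : G -> set A) :=
  [/\ forall d, is_ideal (K d),
      K 0 1 &
      forall d e a b, K d a -> K e b -> K (d + e) (a * b)].

Lemma is_ideal_opp (A : comPzRingType) (I : set A) a :
  is_ideal I -> I a -> I (- a).
Proof. by case=> _ _ IM Ia; rewrite -mulN1r; apply: IM. Qed.

Lemma is_ideal_sum (A : comPzRingType) (I : set A) (T : Type) (r : seq T)
    (P : pred T) (F : T -> A) :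
  is_ideal I -> (forall t, P t -> I (F t)) -> I (\sum_(t <- r | P t) F t).
Proof. by case=> I0 ID _ IF; apply: big_ind. Qed.

Section Homogeneous.
Variables (G : zmodType) (A : comNzRingType) (K : G -> set A).
Hypothesis gradK : graded_ideals K.
Variable g : G.

(** Homogeneity of degree [d] in the polynomial ring, with ['X] of degree [g]. *)
Definition homogeneous (d : G) (p : {poly A}) := forall k, K (d - g *+ k) p`_k.

Lemma homogeneousM d e p q :
  homogeneous d p -> homogeneous e q -> homogeneous (d + e) (p * q).
Proof.
case: gradK => idK _ KM hp hq k; rewrite coefM.
apply: is_ideal_sum => // i _.
have -> : d + e - g *+ k = (d - g *+ i) + (e - g *+ (k - i)).
  by rewrite addrACA -opprD -mulrnDr subnKC // -ltnS.
exact: KM.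
Qed.

Lemma homogeneousC c d : K d c -> homogeneous d c%:P.
Proof.
case: gradK => idK _ _ Kc k; rewrite coefC; case: eqP => [->|_].
  by rewrite subr0.
by case: (idK (d - g *+ k)).
Qed.

Lemma homogeneousX : homogeneous g 'X.
Proof.
case: gradK => idK K1 _ k; rewrite coefX; case: eqP => [->|_].
  by rewrite subrr.
by case: (idK (g - g *+ k)).
Qed.

Lemma homogeneous_prod (T : Type) (r : seq T) (d : T -> G) (F : T -> {poly A}) :
  (forall t, homogeneous (d t) (F t)) ->
  homogeneous (\sum_(t <- r) d t) (\prod_(t <- r) F t).
Proof.
move=> hF; elim/big_rec2: _ => [|t p e _ hp]; last exact: homogeneousM.
by rewrite -polyC1; apply: homogeneousC; case: gradK.
Qed.

(** The term of a permutation s in the Leibniz expansion has degree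
    sum_i (w i + g - w (s i)), and the weights cancel because s is a bijection.
    The diagonal entries of X - M fit because M i i has the degree g of X. *)
Lemma homogeneous_char_poly N (M : 'M[A]_N) (w : 'I_N -> G) :
  (forall i j, K (w i + g - w j) (M i j)) -> homogeneous (g *+ N) (char_poly M).
Proof.
case: (gradK) => idK _ _ hM k.
rewrite /char_poly /determinant coef_sum; apply: is_ideal_sum => // s _.
rewrite -(rmorph_sign (polyC : _ -> {poly A})) coefCM.
case: (idK (g *+ N - g *+ k)) => _ _; apply.
have -> : g *+ N = \sum_i (w i + g - w (s i)).
  rewrite big_split /= big_split /= sumrN.
  rewrite [X in _ = _ - X](_ : _ = \sum_i w i).
    by rewrite addrAC subrr add0r sumr_const card_ord.
  by rewrite [RHS](reindex_inj (@perm_inj _ s)).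
apply: homogeneous_prod => i {}k.
rewrite !mxE coefB; case: (idK (w i + g - w (s i) - g *+ k)) => _ KD _.
apply: KD; last first.
  by apply: is_ideal_opp => //; apply: homogeneousC.
rewrite coefMn; case: eqP => [<-|_]; last by case: (idK (w i + g - w (s i) - g *+ k)).
by rewrite mulr1n [w i + g]addrC addrK; apply: homogeneousX.
Qed.

End Homogeneous.

(** The determinant trick: the value of the characteristic polynomial is
    det (u - M), and the adjugate of u - M multiplied by u - M, which kills v,
    is this scalar.  Over a ring with zero divisors, v cannot be cancelled. *)
Lemma horner_char_poly_eigen (A B : comNzRingType) (f : {rmorphism A -> B}) N
    (M : 'M[A]_N) (v : 'cV[B]_N) u :
  map_mx f M *m v = u *: v -> (map_poly f (char_poly M)).[u] *: v = 0.
Proof.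
move=> Mv.
have -> : (map_poly f (char_poly M)).[u] = \det (u%:M - map_mx f M).
  rewrite map_char_poly -[LHS]/(horner_eval u _) -det_map_mx; congr (\det _).
  apply/matrixP => i j; rewrite !mxE /= /horner_eval.
  by rewrite hornerD hornerN hornerMn hornerX hornerC.
by rewrite -mul_scalar_mx -mul_adj_mx -mulmxA mulmxBl mul_scalar_mx Mv subrr mulmx0.
Qed.

(** With zero ideals in negative degrees, the vanishing of companion matrix
    entries above the superdiagonal becomes a degree condition. *)
Definition int_extend (A : comPzRingType) (I : nat -> set A) (z : int) : set A :=
  if z is Posz r then I r else [set 0]%classic.

Lemma graded_int_extend (A : comPzRingType) (I : nat -> set A) :
  ideal_semifiltration I -> graded_ideals (int_extend I).
Proof.
case=> idI I0 IM.
have idE d : is_ideal (int_extend I d).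
  case: d => [r|r]; first exact: idI.
  split=> //= [a b -> ->|c a ->]; [by rewrite addr0|by rewrite mulr0].
split=> //; first by rewrite /= I0.
move=> [r|r] [s|s] a b.
- by move=> Ia Ib; apply/IM/ideal_mul_mem.
- by move=> _ /= ->; rewrite mulr0; case: (idE (Posz r + Negz s)).
- by move=> /= -> _; rewrite mul0r; case: (idE (Negz r + Posz s)).
- by move=> /= -> _; rewrite mul0r; case: (idE (Negz r + Negz s)).
Qed.

Lemma graded_ideal_mul (G H : zmodType) (A : comPzRingType)
    (K : G -> set A) (L : H -> set A) :
  graded_ideals K -> graded_ideals L ->
  graded_ideals (fun d : G * H => ideal_mul (K d.1) (L d.2)).
Proof.
case=> idK K1 KM [idL L1 LM]; split.
- by move=> d; apply: ideal_mul_ideal.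
- by rewrite -[1]mulr1; apply: ideal_mul_mem.
move=> d e a b [s [sP ->]] [t [tP ->]].
have idKL := ideal_mul_ideal (idK (d + e).1) (idL (d + e).2).
rewrite mulr_suml big_seq; apply: is_ideal_sum => // p /sP[Kp Lp].
rewrite mulr_sumr big_seq; apply: is_ideal_sum => // q /tP[Kq Lq].
by rewrite mulrACA; apply: ideal_mul_mem; [apply: KM|apply: LM].
Qed.

(** Row i < m - 1 shifts x^i to x^(i+1) with coefficient 1, of degree 0; the
    last row holds the coefficients -a_k, of degree m - k = i + 1 - k. *)
Lemma companion_matrix (A B : comPzRingType) (f : {rmorphism A -> B})
    (I : nat -> set A) m x :
  ideal_semifiltration I -> n_integral f I m x ->
  exists P : 'M[A]_m,
    (forall i, \sum_k f (P i k) * x ^+ k = x ^+ i.+1) /\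
    (forall i k : 'I_m, int_extend I (i%:Z + 1 - k%:Z) (P i k)).
Proof.
move=> sI [a [ax0 a1 aI]].
have [idE E1 _] := graded_int_extend sI.
exists (\matrix_(i, k) if i.+1 == m then - a (widen_ord (leqnSn m) k)
                       else (k == i.+1 :> nat)%:R); split=> [i|i k].
  have [im|im] := eqVneq i.+1 m.
    under eq_bigr => k _ do rewrite mxE im eqxx rmorphN mulNr.
    rewrite sumrN; apply/eqP; rewrite eq_sym -addr_eq0 addrC im; apply/eqP.
    by move: ax0; rewrite big_ord_recr /= a1 rmorph1 mul1r.
  have lt_im : (i.+1 < m)%N by rewrite ltn_neqAle im ltn_ord.
  rewrite (bigD1 (Ordinal lt_im)) //= mxE (negPf im) eqxx rmorph1 mul1r.
  rewrite big1 ?addr0 // => k; rewrite -val_eqE /= => ki.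
  by rewrite mxE (negPf im) (negPf ki) rmorph0 mul0r.
rewrite mxE -PoszD addn1; case: eqP => im.
  rewrite im subzn ?(ltnW (ltn_ord k)) //=.
  apply: is_ideal_opp; first by case: sI.
  exact: (aI (widen_ord (leqnSn m) k)).
case: eqP => [->|_]; first by rewrite subrr.
by case: (idE (i.+1%:Z - k%:Z)).
Qed.

Lemma n_integral_trivial (A B : comPzRingType) (f : {rmorphism A -> B})
    (I : nat -> set A) n u :
  ideal_semifiltration I -> 1 = 0 :> B -> n_integral f I n u.
Proof.
case=> idI I0 _ B0; exists (fun k => (k == ord_max)%:R); split.
- by rewrite -[LHS]mulr1 B0 mulr0.
- by rewrite eqxx.
move=> i; case: eqP => [->|_]; first by rewrite subnn I0.
by case: (idI (n - i)%N).
Qed.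

Lemma n_integral_mul_nontrivial (A B : comNzRingType) (f : {rmorphism A -> B})
    (I J : nat -> set A) x y m n :
  ideal_semifiltration I -> ideal_semifiltration J ->
  n_integral f I m x -> n_integral f J n y ->
  n_integral f (semifiltration_mul I J) (n * m) (x * y).
Proof.
move=> sI sJ hx hy.
(* An integral equation of degree 0 would read 1 = 0. *)
have deg_gt0 (K : nat -> set A) d z : n_integral f K d z -> (0 < d)%N.
  case: d => // -[a [/eqP + a1 _]].
  by rewrite big_ord1 (_ : ord0 = ord_max) ?a1 ?rmorph1 ?mul1r ?oner_eq0 //; apply: val_inj.
have [m_gt0 n_gt0] := (deg_gt0 _ _ _ hx, deg_gt0 _ _ _ hy).
have [P [xP PI]] := companion_matrix sI hx.
have [Q [yQ QJ]] := companion_matrix sJ hy.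
set T := ('I_n * 'I_m)%type; set N := #|{: T}|.
have NE : (n * m)%N = N by rewrite /N card_prod !card_ord.
rewrite NE.
pose e (s : 'I_N) : T := enum_val s.
pose M : 'M[A]_N := \matrix_(s, t) (P (e s).2 (e t).2 * Q (e s).1 (e t).1).
pose v : 'cV[B]_N := \col_s (x ^+ (e s).2 * y ^+ (e s).1).
have Mv : map_mx f M *m v = (x * y) *: v.
  apply/colP => s; rewrite !mxE mulrACA -!exprS -xP -yQ big_distrlr /=.
  rewrite exchange_big pair_big /= (reindex e) /=; last first.
    exact/onW_bij/enum_val_bij.
  by apply: eq_bigr => t _; rewrite !mxE rmorphM mulrACA.
have char0 : (map_poly f (char_poly M)).[x * y] = 0.
  (* The eigenvector has the entry x^0 y^0 = 1. *)
  pose s0 : 'I_N := enum_rank (Ordinal n_gt0, Ordinal m_gt0).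
  have /colP/(_ s0) := horner_char_poly_eigen Mv.
  by rewrite !mxE /e enum_rankK !expr0 !mulr1.
pose g : int * int := (1, 1).
pose w (s : 'I_N) : int * int := ((e s).2%:Z, (e s).1%:Z).
have gK := graded_ideal_mul (graded_int_extend sI) (graded_int_extend sJ).
pose K (d : int * int) := ideal_mul (int_extend I d.1) (int_extend J d.2).
have hchar : homogeneous K g (g *+ N) (char_poly M).
  apply: (@homogeneous_char_poly _ _ _ gK g N M w) => s t.
  by rewrite mxE; apply: ideal_mul_mem; [apply: PI|apply: QJ].
exists (fun k => (char_poly M)`_k); split.
- rewrite -[RHS]char0 (@horner_coef_wide _ N.+1).
    by apply: eq_bigr => k _; rewrite coef_map.
  by rewrite -(size_char_poly M) size_poly.
- by have /monicP := char_poly_monic M; rewrite lead_coefE size_char_poly.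
move=> i; have := hchar i; rewrite -mulrnBr -1?ltnS //.
have gE k : g *+ k = (k%:Z, k%:Z).
  by elim: k => [|k IHk]; rewrite ?mulr0n // mulrS IHk.
by rewrite gE.
Qed.

Theorem theorem3p4 (A B : comPzRingType) (f : {rmorphism A -> B})
    (I J : nat -> set A)
    (hI : ideal_semifiltration I) (hJ : ideal_semifiltration J)
    (x y : B) (m n : nat)
    (hx : n_integral f I m x) (hy : n_integral f J n y) :
  n_integral f (semifiltration_mul I J) (n * m)%N (x * y).
Proof.
have [B0|B1] := eqVneq (1 : B) 0.
  by apply: n_integral_trivial => //; apply: semifiltration_mulP.
have A1 : (1 : A) != 0.
  by apply: contraNneq B1 => A0; rewrite -(rmorph1 f) A0 rmorph0.
pose A' : comNzRingType := HB.pack (A : Type)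
  (GRing.ComPzRing.on A) (GRing.PzSemiRing_isNonZero.Build A A1).
pose B' : comNzRingType := HB.pack (B : Type)
  (GRing.ComPzRing.on B) (GRing.PzSemiRing_isNonZero.Build B B1).
exact: (@n_integral_mul_nontrivial A' B' f).
Qed.
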